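(* Let $\tau$ and $Z$ be independent random variables with values in $(0,+\infty)$ and $\mathbb{R}$ respectively, and let $\zeta$ be the Lévy bridge with random length $\tau$ and pinning point $Z$ associated with the Lévy process $X$. Let $a_{ac}\in[0,1]$ be the weight of the absolutely continuous part in the Lebesgue decomposition of the law of $Z$. If $a_{ac}=0$, then $\zeta$ is Markovian.
   Context: Everything is defined on a complete probability space $(\Omega,\mathcal{F},\mathbb{P})$; $\mathbb{P}_\theta$ denotes the law of a random variable $\theta$ under $\mathbb{P}$. Let $X=(X_t,t\ge0)$ be a one-dimensional Lévy process (realized as the coordinate process on the Skorohod space of càdlàg functions). Standing assumption: for every $t>0$ the law of $X_t$ is absolutely continuous with respect to Lebesgue measure, with density $f^X_t$. Deterministic bridges: for $r>0$ and $z\in\mathbb{R}$ with $0<f^X_r(z)<+\infty$, $\mathbb{P}^{r,z}$ denotes the unique probability measure such that $\mathbb{P}^{r,z}|_{\mathcal{F}^X_t}=\frac{f^X_{r-t}(z-X_t)}{f^X_r(z)}\,\mathbb{P}|_{\mathcal{F}^X_t}$ for all $t<r$, where $\mathcal{F}^X_t=\sigma(X_s,s\le t)$; it is the law of the bridge from $0$ to $z$ of length $r$ associated with $X$. $X^{r,z}=(X^{r,z}_t)_{0\le t\le r}$ denotes a càdlàg process with this law; it satisfies $\mathbb{P}(X^{r,z}_0=0,X^{r,z}_r=z)=1$, and for $0=t_0<t_1<\dots<t_n<r$ and $x_0=0$, $$\mathbb{P}(X^{r,z}_{t_1}\in \mathrm{d}x_1,\ldots,X^{r,z}_{t_n}\in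 \mathrm{d}x_n)=\frac{f^X_{r-t_n}(z-x_n)}{f^X_r(z)}\prod_{i=1}^n f^X_{t_i-t_{i-1}}(x_i-x_{i-1})\,\mathrm{d}x_1\ldots \mathrm{d}x_n.$$ The process $X^{r,z}$ is extended to $[0,\infty)$ by setting $X^{r,z}_t=z$ for $t\ge r$. Random bridges: for independent $\tau$ and $Z$ with values in $(0,+\infty)$ and $\mathbb{R}$ respectively, a process $\zeta=(\zeta_t,t\ge0)$ is the Lévy bridge with random length $\tau$ and pinning point $Z$ associated with (derived from) $X$ if: (i) $0<f^X_r(z)<\infty$ for $\mathbb{P}_{(\tau,Z)}$-almost every $(r,z)$; (ii) the conditional distribution of $\zeta$ given $\{\tau=r,Z=z\}$ is the law of the (extended) process $X^{r,z}$. Lebesgue decomposition: the law of $Z$ is written $\mathbb{P}_Z=(1-a_{ac})\mathbb{P}^{s}_Z+a_{ac}\mathbb{P}^{ac}_Z$ with $a_{ac}\in[0,1]$, where $\mathbb{P}^{ac}_Z$ is a probability measure absolutely continuous with respect to Lebesgue measure and $\mathbb{P}^s_Z$ is a probability measure singular with respect to Lebesgue measure. ''Markovian'' means with respect to the natural filtration $\mathcal{F}^\zeta_t=\sigma(\zeta_s,s\le t)$: for all $0\le t<u$ and all bounded measurable $g:\mathbb{R}\to\mathbb{R}$, $\mathbb{E}[g(\zeta_u)\mid\mathcal{F}^\zeta_t]=\mathbb{E}[g(\zeta_u)\mid\zeta_t]$, $\mathbb{P}$-a.s. *)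

(* Defs.v *)
From HB Require Import structures.
From mathcomp Require Import all_boot all_order all_algebra.
From mathcomp Require Import all_classical all_reals all_analysis.
From mathcomp Require Import measurable_realfun.
Set Implicit Arguments.
Unset Strict Implicit.
Unset Printing Implicit Defensive.
Import Order.TTheory GRing.Theory Num.Theory.
Import numFieldNormedType.Exports.
Local Open Scope classical_set_scope.
Local Open Scope ring_scope.

(* A function on [0, +oo[ is encoded as a function on R that is constant on
   ]-oo, 0], so that two distinct paths differ at some nonnegative time. *)
Definition cadlag (R : realType) (w : R -> R) : Prop :=
  [/\ forall t, 0 <= t -> w s @[s --> t^'+] --> w t,
      forall t, 0 < t -> cvg (w s @[s --> t^'-])
    & forall t, t <= 0 -> w t = w 0].

Lemma cadlag_cst0 (R : realType) : cadlag (cst 0 : R -> R).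
Proof.
by split=> // t _; [exact: cvg_cst | exact: is_cvg_cst].
Qed.

Record skorohod (R : realType) := Skorohod {
  skorohod_fun :> R -> R;
  skorohod_cadlag : cadlag skorohod_fun }.

HB.instance Definition _ (R : realType) := gen_eqMixin (skorohod R).
HB.instance Definition _ (R : realType) := gen_choiceMixin (skorohod R).
HB.instance Definition _ (R : realType) :=
  isPointed.Build (skorohod R) (Skorohod (cadlag_cst0 R)).

Definition coordinate (R : realType) (t : R) (w : skorohod R) : R := w t.

Definition sigma_rv (R : realType) (T : Type) (Y : T -> R) : set (set T) :=
  preimage_set_system setT Y measurable.

Definition cylinders (R : realType) : set (set (skorohod R)) :=
  \bigcup_(s in [set s : R | 0 <= s]) sigma_rv (coordinate s).

HB.instance Definition _ (R : realType) :=
  @isMeasurable.Build (sigma_display (@cylinders R)) (skorohod R)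
    <<s @cylinders R >> (@sigma_algebra0 _ setT (@cylinders R))
    (@sigma_algebraC _ (@cylinders R))
    (@sigma_algebra_bigcup _ setT (@cylinders R)).

Definition natural_filtration (R : realType) (T : Type) (Y : R -> T -> R)
    (t : R) : set (set T) :=
  <<s \bigcup_(s in [set s : R | 0 <= s <= t]) sigma_rv (Y s) >>.

(* PX is the law of a Levy process, i.e. the coordinate process on the path
   space is a Levy process under PX; path regularity is built into the
   carrier. *)
Definition levy_process_law (R : realType) (PX : probability (skorohod R) R)
    : Prop :=
  [/\ \forall w \ae PX, coordinate 0 w = 0,
      forall s t : R, 0 <= s -> s <= t -> forall A B,
        natural_filtration (@coordinate R) s A -> measurable B ->
        PX (A `&` [set w | B (coordinate t w - coordinate s w)])
        = (PX A * PX [set w | B (coordinate t w - coordinate s w)%R])%E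
    & forall s t : R, 0 <= s -> s <= t -> forall B, measurable B ->
        PX [set w | B (coordinate t w - coordinate s w)]
        = PX [set w | B (coordinate (t - s) w)]].

(* For each t > 0, f t is one version of the density of X_t. Versions matter
   below, since bridges evaluate f at single points; nothing is required of
   the choice beyond what the existence of the bridge laws entails. *)
Definition marginal_densities (R : realType) (PX : probability (skorohod R) R)
    (f : R -> R -> \bar R) : Prop :=
  forall t : R, 0 < t ->
    [/\ measurable_fun setT (f t), forall x, (0 <= f t x)%E
      & forall B, measurable B ->
        PX [set w | B (coordinate t w)] = (\int[lebesgue_measure]_(x in B) f t x)%E].

(* Q is the law of the bridge of length r from 0 to z, extended by the value z
   on [r, +oo[. *)
Definition bridge_law (R : realType) (PX : probability (skorohod R) R)
    (f : R -> R -> \bar R) (r z : R) (Q : {measure set (skorohod R) -> \bar R})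
    : Prop :=
  (forall t : R, 0 <= t -> t < r -> forall A, natural_filtration (@coordinate R) t A ->
     Q A = (\int[PX]_(w in A) (f (r - t)%R (z - coordinate t w)%R / f r z))%E)
  /\ \forall w \ae Q, forall t, r <= t -> coordinate t w = z.

Definition rv_pair (d : measure_display) (T : measurableType d) (R : realType)
  (X Y : {mfun T >-> R}) (w : T) : R * R := (X w, Y w).

Lemma measurable_rv_pair (d : measure_display) (T : measurableType d)
  (R : realType) (X Y : {mfun T >-> R}) : measurable_fun setT (rv_pair X Y).
Proof. exact: measurable_fun_pair. Qed.

HB.instance Definition _ (d : measure_display) (T : measurableType d)
    (R : realType) (X Y : {mfun T >-> R}) :=
  isMeasurableFun.Build _ _ _ _ (rv_pair X Y) (measurable_rv_pair X Y).

Definition independent_rv (d : measure_display) (T : measurableType d)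
    (R : realType) (P : probability T R) (X Y : {RV P >-> R}) : Prop :=
  forall A B, measurable A -> measurable B ->
    P (X @^-1` A `&` Y @^-1` B) = (P (X @^-1` A) * P (Y @^-1` B))%E.

Definition regular_conditional_law (d d1 d2 : measure_display)
    (T : measurableType d) (U : measurableType d1) (V : measurableType d2)
    (R : realType) (P : probability T R) (Y : {mfun T >-> V})
    (X : {mfun T >-> U}) (K : R.-pker U ~> V) : Prop :=
  forall A B, measurable A -> measurable B ->
    P (X @^-1` A `&` Y @^-1` B) = (\int[distribution P X]_(x in A) K x B)%E.

Definition levy_bridge (d : measure_display) (T : measurableType d)
    (R : realType) (P : probability T R) (PX : probability (skorohod R) R)
    (f : R -> R -> \bar R) (tau Z : {RV P >-> R}) (zeta : {RV P >-> skorohod R})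
    : Prop :=
  (\forall x \ae distribution P (rv_pair tau Z), (0 < f x.1 x.2 < +oo)%E) /\
  exists2 K : R.-pker (R * R)%type ~> skorohod R,
    regular_conditional_law P zeta (rv_pair tau Z) K
    & \forall x \ae distribution P (rv_pair tau Z),
        bridge_law PX f x.1 x.2 (K x).

Definition mutually_singular (d : measure_display) (T : measurableType d)
    (R : realType) (mu nu : set T -> \bar R) : Prop :=
  exists2 N, measurable N & mu N = 0%E /\ nu (~` N) = 0%E.

Definition ac_weight (R : realType) (mu : probability R R) (a : R) : Prop :=
  0 <= a <= 1 /\
  exists Ps Pac : probability R R,
    [/\ mutually_singular Ps (@lebesgue_measure R), Pac `<< (@lebesgue_measure R)
      & forall A, measurable A ->
          mu A = ((1 - a)%:E * Ps A + a%:E * Pac A)%E].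

(* V is a version of the conditional expectation of Y given the
   sigma-algebra G. *)
Definition cond_expectation (d : measure_display) (T : measurableType d)
    (R : realType) (P : probability T R) (G : set (set T)) (Y V : T -> R)
    : Prop :=
  [/\ forall B, measurable B -> G (V @^-1` B),
      P.-integrable setT (EFin \o V)
    & forall A, G A ->
        (\int[P]_(w in A) (V w)%:E = \int[P]_(w in A) (Y w)%:E)%E].

(* Versions of a conditional expectation exist and are unique up to null sets,
   so asserting the identity for one pair of versions asserts it for all. *)
Definition markovian (d : measure_display) (T : measurableType d)
    (R : realType) (P : probability T R) (Y : R -> T -> R) : Prop :=
  forall t u : R, 0 <= t -> t < u ->
  forall g : R -> R, measurable_fun setT g -> bounded_fun g ->
  exists V W : T -> R,
    [/\ cond_expectation P (natural_filtration Y t) (g \o Y u) V,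
        cond_expectation P (sigma_rv (Y t)) (g \o Y u) W
      & \forall w \ae P, V w = W w].

(* Main.v *)
(* When a_ac = 0, [Z] lives in a Lebesgue-null set [D]. Before [tau] the bridge
   has a diffuse law, so it avoids [D] at a fixed time t > 0, while from [tau] on
   it sits at [Z], which is in [D]. Hence {t < tau} = {zeta_t \notin D} almost
   surely, and on {zeta_t \in D} one has zeta_u = zeta_t.

   It remains to treat {t < tau}. No joint measurability of the densities in
   (r, z) is available, so the law of zeta cannot be handled by Fubini through
   the bridge densities. Instead, for A in F_t, let p_A(X_t) be the conditional
   probability of A given X_t under the Levy law. The Markov property of X and
   the fact that the bridge density on F_u only depends on X_u give, for every
   bridge with length r > t and every u >= t,
     E[1_A k(X_u)] = E[p_A(X_t) k(X_u)].
   This identity is linear in the law of the bridge and p_A does not depend on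
   (r, z): it survives mixing over the law of (tau, Z), and expresses that
   F_t and zeta_u are conditionally independent given zeta_t on {t < tau}.
   At t = 0 the past is generated by zeta_0 and there is nothing to prove. *)
Require Import Defs.
From HB Require Import structures.
From mathcomp Require Import all_boot all_order all_algebra.
From mathcomp Require Import all_classical all_reals all_analysis.
From mathcomp Require Import measurable_realfun.
Import Order.TTheory GRing.Theory Num.Theory.
Import numFieldNormedType.Exports.
Local Open Scope classical_set_scope.
Local Open Scope ring_scope.

(** * Functionals on nonnegative measurable functions that are determined by indicators *)

Section positive_functional.
Local Open Scope ereal_scope.
Context {d} {U : measurableType d} {R : realType}.

(** What integration against a measure satisfies on nonnegative functions, kept abstract so that
    weighted integrals and iterated integrals against a kernel are compared by one argument. *)
Definition positive_functional (I : (U -> \bar R) -> \bar R) :=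
  [/\ forall f g, measurable_fun setT f -> measurable_fun setT g ->
        (forall x, 0 <= f x) -> (forall x, 0 <= g x) ->
        I (fun x => f x + g x) = I f + I g,
      forall (c : R) (f : U -> \bar R), (0 <= c)%R -> measurable_fun setT f ->
        (forall x, 0 <= f x) -> I (fun x => c%:E * f x) = c%:E * I f
    & forall f_ : (U -> \bar R)^nat, (forall n, measurable_fun setT (f_ n)) ->
        (forall n x, 0 <= f_ n x) -> (forall x, nondecreasing_seq (f_ ^~ x)) ->
        I (fun x => limn (f_ ^~ x)) = limn (fun n => I (f_ n))].

Import HBNNSimple.

(** Additivity and homogeneity carry the equality from indicators to simple functions, and every
    nonnegative measurable function is an increasing limit of simple ones. *)
Lemma positive_functional_ext (I J : (U -> \bar R) -> \bar R) :
  positive_functional I -> positive_functional J ->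
  (forall B, measurable B -> I (EFin \o \1_B) = J (EFin \o \1_B)) ->
  forall f : U -> \bar R, measurable_fun setT f -> (forall x, 0 <= f x) ->
  I f = J f.
Proof.
move=> [ID IZ Ilim] [JD JZ Jlim] IJ f mf f0.
have simple_eq (h : {nnsfun U >-> R}) : I (EFin \o h) = J (EFin \o h).
  (* The values of [h] are nonnegative, so [Num.max y 0] changes nothing; it makes every coefficient
     visibly nonnegative, as homogeneity requires, even for a [y] not known to be in the range. *)
  have -> : EFin \o h = (fun x => \sum_(y <- finmap.enum_fset (fset_set (range h)))
      (Num.max y 0)%:E * (EFin \o \1_(h @^-1` [set y])) x).
    apply/funext => x /=; rewrite fimfunE -fsumEFin//.
    transitivity (\sum_(y \in range h)
        (Num.max y 0)%:E * (\1_(h @^-1` [set y]) x)%:E); last first.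
      by rewrite fsbig_finite.
    by apply: eq_fsbigr => y; rewrite inE => -[z _ <-]; rewrite EFinM max_l.
  elim: (finmap.enum_fset _) => [|y s IH].
    (* The empty sum: homogeneity with factor 0 gives the value 0 at the zero function, since 0
       times any extended real is 0. *)
    have z (K : (U -> \bar R) -> \bar R) : (forall (c : R) g, (0 <= c)%R ->
        measurable_fun setT g -> (forall x, 0 <= g x) ->
        K (fun x => c%:E * g x) = c%:E * K g) ->
      K (fun=> 0) = 0.
      move=> KZ; have := KZ 0%R (cst 0) (lexx _) (@measurable_cst _ _ _ _ _ _)
        (fun=> lexx _).
      by rewrite mul0e; under eq_fun do rewrite mule0.
    by under eq_fun do rewrite big_nil; rewrite (z I IZ) (z J JZ).
  have m1 B : measurable B -> measurable_fun setT (EFin \o \1_B : U -> \bar R).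
    by move=> mB; exact/measurable_EFinP.
  have mh y' : measurable (h @^-1` [set y']) by [].
  under eq_fun do rewrite big_cons.
  have p0 (y' : R) : (0 <= Num.max y' 0)%R by rewrite le_max lexx orbT.
  have i0 y' x : 0 <= (EFin \o \1_(h @^-1` [set y'])) x :> \bar R.
    by rewrite lee_fin.
  rewrite ID ?JD ?IZ ?JZ ?IH ?IJ//; try by [exact: m1|
    apply: measurable_funeM; exact: m1 |
    apply: emeasurable_sum => ?; apply: measurable_funeM; exact: m1 |
    move=> x; apply: sume_ge0 => ? _; rewrite mule_ge0// ?lee_fin |
    move=> x; rewrite mule_ge0// ?lee_fin]; fail.
have fE : f = (fun x => limn (fun n => (EFin \o nnsfun_approx measurableT mf n) x)).
  apply/funext => x; apply/esym/cvg_lim => //.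
  by apply: (cvg_nnsfun_approx measurableT mf) => // y _; exact: f0.
have mn n : measurable_fun setT (EFin \o nnsfun_approx measurableT mf n).
  exact/measurable_EFinP.
have nd x : nondecreasing_seq
    ((fun n => EFin \o nnsfun_approx measurableT mf n) ^~ x).
  by move=> a b ab; rewrite lee_fin; exact/lefP/nd_nnsfun_approx.
rewrite fE Ilim// ?Jlim//; try by move=> n x; rewrite lee_fin.
by congr (limn _); apply/funext => n; exact: simple_eq.
Qed.

End positive_functional.

(* Unlike [limeMl], this allows [c = +oo]. *)
Lemma ge0_limeMl {R : realType} {c : \bar R} {u : (\bar R)^nat} :
  (0 <= c)%E -> (forall n, 0 <= u n)%E -> nondecreasing_seq u ->
  limn (fun n => c * u n)%E = (c * limn u)%E.
Proof.
move=> c0 u0 ndu.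
have cu : cvg (u @ \oo) by exact: ereal_nondecreasing_is_cvgn.
have ulim n : (u n <= limn u)%E.
  rewrite (cvg_lim _ (ereal_nondecreasing_cvgn ndu))//.
  by apply: ereal_sup_ubound; exists n.
case: c c0 => [c _|_|//]; first by rewrite limeMl.
have [lu0|lu0] := eqVneq (limn u) 0%E.
  have uE n : u n = 0%E by apply/eqP; rewrite eq_le u0 -lu0 ulim.
  rewrite lu0 mule0; under eq_fun do rewrite uE mule0.
  exact: lim_cst.
have lim0 : (0 <= limn u)%E by apply: lime_ge => //; exact: nearW.
rewrite (@limeM _ _ _ _ (cst +oo%E))//; [|exact: is_cvg_cst|].
  by rewrite lim_cst.
by rewrite lim_cst// /mule_def/=; case: (limn u) lu0.
Qed.

Section positive_functional_integral.
Local Open Scope ereal_scope.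
Context {d d'} {T : measurableType d} {U : measurableType d'} {R : realType}.
Variables (mu : {measure set T -> \bar R}) (D : set T) (mD : measurable D).

(** One form covers changes of measure ([Y] the identity) and image measures ([F] constant 1). The
    weight may be infinite, hence the use of [ge0_limeMl]. *)
Lemma positive_functional_weighted (F : T -> \bar R) (Y : T -> U) :
  measurable_fun setT F -> (forall t, 0 <= F t) -> measurable_fun setT Y ->
  positive_functional (fun k => \int[mu]_(t in D) (F t * k (Y t))).
Proof.
move=> mF F0 mY.
have mk k : measurable_fun setT k -> measurable_fun D (fun t => F t * k (Y t)).
  by move=> mk; apply: measurable_funTS; apply: emeasurable_funM => //;
     exact: measurableT_comp.
split=> [f g mf mg f0 g0|c f c0 mf f0|f_ mf f0 ndf].
- rewrite -ge0_integralD//; try by [exact: mk|move=> ? _; rewrite mule_ge0].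
  by apply: eq_integral => t _; rewrite ge0_muleDr.
- rewrite -ge0_integralZl//; try by [exact: mk|move=> ? _; rewrite mule_ge0].
  by apply: eq_integral => t _; rewrite muleCA.
- rewrite -monotone_convergence//.
  + by apply: eq_integral => t _; rewrite (ge0_limeMl (F0 t))//; exact: ndf.
  + by move=> n; exact: mk.
  + by move=> n t _; rewrite mule_ge0.
  + by move=> t _ a b ab; rewrite lee_wpmul2l//; exact: ndf.
Qed.

Lemma positive_functional_kernel (K : R.-pker T ~> U) :
  positive_functional (fun k => \int[mu]_(t in D) \int[K t]_y k y).
Proof.
have mk k : measurable_fun setT k -> (forall y, 0 <= k y) ->
    measurable_fun D (fun t => \int[K t]_y k y).
  move=> mk k0; apply: measurable_funTS.
  by apply: measurable_fun_integral_kernel => // B mB; exact: measurable_kernel.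
split=> [f g mf mg f0 g0|c f c0 mf f0|f_ mf f0 ndf].
- rewrite -ge0_integralD//; try by [exact: mk|move=> ? _; exact: integral_ge0].
  by apply: eq_integral => t _; rewrite ge0_integralD.
- rewrite -ge0_integralZl//; try by [exact: mk|move=> ? _; exact: integral_ge0].
  by apply: eq_integral => t _; rewrite ge0_integralZl.
- rewrite -monotone_convergence//.
  + by apply: eq_integral => t _; rewrite monotone_convergence.
  + by move=> n; exact: mk.
  + by move=> n t _; exact: integral_ge0.
  + move=> t _ a b ab; apply: ge0_le_integral => // y _; exact: ndf.
Qed.

End positive_functional_integral.

(** * Conditional expectation given a variable, and integration of independent variables *)

(* [h] is the conditional expectation of [F] given [Y] as a function of [Y]. *)
Lemma conditional_density d d' (T : measurableType d) (U : measurableType d')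
    (R : realType) (P : probability T R) (Y : {mfun T >-> U}) (F : T -> \bar R) :
  (forall t, 0 <= F t)%E -> P.-integrable setT F ->
  exists h : U -> R, [/\ measurable_fun setT h, forall y, 0 <= h y
    & forall k : U -> \bar R, measurable_fun setT k -> (forall y, 0 <= k y)%E ->
      (\int[P]_t (F t * k (Y t)) = \int[P]_t ((h (Y t))%:E * k (Y t)))%E].
Proof.
move=> F0 iF; have mF := measurable_int _ iF.
(* The image under [Y] of the measure with density [F]. It is finite and dominated by the law of
   [Y]; [h] is its Radon-Nikodym derivative, which is finite everywhere, so [fine] loses nothing. *)
pose nu (B : set U) := (\int[P]_(t in Y @^-1` B) F t)%E.
have mY B : measurable B -> measurable (Y @^-1` B).
  by move=> mB; rewrite -[X in measurable X]setTI; exact: measurable_funP.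
have nu0 : nu set0 = 0%E by rewrite /nu preimage_set0 integral_set0.
have nu_ge0 B : (0 <= nu B)%E by exact: integral_ge0.
have nu_sigma : semi_sigma_additive nu.
  move=> B mB tB mUB; rewrite /nu preimage_bigcup.
  apply: semi_sigma_additive_nng_induced => //.
  - by move=> n; exact: mY.
  - apply/trivIsetP => i j _ _ ij; rewrite -preimage_setI.
    by move/trivIsetP : tB => ->//; rewrite preimage_set0.
  - by rewrite -preimage_bigcup; exact: mY.
have nu_fin : fin_num_fun nu.
  move=> B mB; apply: integrable_fin_num => //; first exact: mY.
  by apply: (integrableS measurableT _ _ iF) => //; exact: mY.
pose nu_measure := isMeasure.Build _ _ _ nu nu0 nu_ge0 nu_sigma.
pose nu' : {measure set U -> \bar R} := HB.pack nu nu_measure.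
pose nu'' := @Measure_isFinite.Build _ _ _ nu' nu_fin.
pose nuf : {finite_measure set U -> \bar R} := HB.pack nu nu_measure nu''.
have nuP : nuf `<< distribution P Y.
  apply/null_content_dominatesP => B mB PB.
  rewrite /= /nu; apply: null_set_integral => //; first exact: mY.
  exact: measurable_funTS.
have [h [h0 hfin ih nuE]] := radon_nikodym_sigma_finite nuP.
have mh := measurable_int _ ih.
exists (fine \o h); split.
- exact: measurableT_comp.
- by move=> y /=; rewrite fine_ge0.
have hE t : ((fine \o h) (Y t))%:E = h (Y t) by rewrite /= fineK.
move=> k mk k0; under [RHS]eq_integral do rewrite hE.
apply: (positive_functional_ext
  (fun k => \int[P]_t (F t * k (Y t)))%E
  (fun k => \int[P]_t (h (Y t) * k (Y t)))%E) => //.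
- exact: positive_functional_weighted.
- by apply: positive_functional_weighted => //; exact: measurableT_comp.
- move=> B mB.
  transitivity (nu B).
    rewrite /nu [RHS]integral_mkcond; apply: eq_integral => t _ /=.
    by rewrite epatch_indic.
  rewrite [LHS]nuE// integral_mkcond ge0_integral_distribution//=.
  - by apply: eq_integral => t _ /=; rewrite epatch_indic.
  - exact/(measurable_restrictT _ _).1/measurable_funTS.
  - by move=> y; rewrite patchE; case: ifP.
Qed.

(** Independence says that the joint law agrees with the product law on rectangles, hence
    everywhere; Tonelli then splits the integral. *)
Lemma independent_integral d d1 d2 (T : measurableType d)
    (U : measurableType d1) (V : measurableType d2) (R : realType)
    (P : probability T R) (X : {mfun T >-> U}) (Y : {mfun T >-> V}) :
  (forall A B, measurable A -> measurable B ->
    P (X @^-1` A `&` Y @^-1` B) = P (X @^-1` A) * P (Y @^-1` B))%E ->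
  forall f : U * V -> \bar R, measurable_fun setT f -> (forall z, 0 <= f z)%E ->
  (\int[P]_t f (X t, Y t) =
   \int[P]_t \int[distribution P Y]_y f (X t, y))%E.
Proof.
move=> XY f mf f0.
have mXY : measurable_fun setT (fun t => (X t, Y t)) by exact: measurable_fun_pair.
pose XYm := isMeasurableFun.Build _ _ _ _ _ mXY.
pose XYf : {mfun T >-> (U * V)%type} := HB.pack (fun t => (X t, Y t)) XYm.
transitivity (\int[distribution P XYf]_z f z)%E.
  by rewrite ge0_integral_distribution.
transitivity (\int[distribution P X \x distribution P Y]_z f z)%E.
  apply: eq_measure_integral => /= A mA _.
  exact/esym/product_measure_unique.
rewrite fubini_tonelli1// ge0_integral_distribution//.
  exact: measurable_fun_fubini_tonelli_F.
by move=> x; apply: integral_ge0.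
Qed.

(** * Measurability of the coordinates with respect to the past *)

(* The path space with the sigma-algebra F_t: [F] is F_t-measurable when
   [measurable_fun setT (F : past t -> _)]. *)
Definition past {R : realType} (t : R) : Type :=
  g_sigma_algebraType
    (\bigcup_(s in [set s : R | 0 <= s <= t]) sigma_rv (@coordinate R s)).
HB.instance Definition _ (R : realType) (t : R) := Measurable.on (@past R t).

Lemma measurable_coordinate {R : realType} {s : R} : 0 <= s ->
  measurable_fun setT (@coordinate R s).
Proof.
move=> s0 _ B mB; apply: sub_sigma_algebra; exists s => //.
by exists B.
Qed.

Lemma measurable_coordinate_past {R : realType} {t s : R} : 0 <= s <= t ->
  measurable_fun setT (@coordinate R s : past t -> R).
Proof.
move=> st _ B mB; apply: sub_sigma_algebra; exists s => //.
by exists B.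
Qed.

Lemma natural_filtration_measurable {R : realType} {t : R} :
  natural_filtration (@coordinate R) t `<=` measurable.
Proof.
apply: smallest_sub; first exact: sigma_algebra_measurable.
move=> A [s /= /andP[s0 _] [B mB <-]]; exact: measurable_coordinate.
Qed.

Lemma natural_filtration_sub {R : realType} {t u : R} : t <= u ->
  natural_filtration (@coordinate R) t `<=` natural_filtration (@coordinate R) u.
Proof.
move=> tu; apply: sub_sigma_algebra2 => A [s /= /andP[s0 st] sA].
by exists s => //=; rewrite s0 (le_trans st).
Qed.

Lemma measurable_fun_past {R : realType} {t : R} {d} {U : measurableType d}
    {F : skorohod R -> U} :
  measurable_fun setT (F : past t -> U) -> measurable_fun setT F.
Proof.
move=> mF _ B mB; apply: (@natural_filtration_measurable _ t).
exact: (mF measurableT _ mB).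
Qed.

(** * The Markov property under the Levy law *)

Section levy.
Local Open Scope ereal_scope.
Context {R : realType} {PX : probability (skorohod R) R}.
Hypothesis PX_levy : levy_process_law PX.
Variables (t u : R).
Hypotheses (t0 : (0 <= t)%R) (tu : (t <= u)%R).

(** The increment X_u - X_t is independent of F_t, so conditioning on F_t averages [k] over the
    increment with X_t frozen. [kappa] is chosen before [phi]: the same function is used below with
    two different weights. *)
Lemma levy_transition (k : R -> \bar R) : measurable_fun setT k ->
  (forall x, 0 <= k x) ->
  exists kappa : R -> \bar R, [/\ measurable_fun setT kappa,
    forall x, 0 <= kappa x
  & forall phi : skorohod R -> \bar R,
      measurable_fun setT (phi : past t -> \bar R) -> (forall w, 0 <= phi w) ->
    \int[PX]_w (phi w * k (coordinate u w)) =
    \int[PX]_w (phi w * kappa (coordinate t w))].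
Proof.
move=> mk k0; have u0 := le_trans t0 tu.
have [_ indep _] := PX_levy.
have mt := measurable_coordinate t0; have mu := measurable_coordinate u0.
pose inc (w : skorohod R) := (coordinate u w - coordinate t w)%R.
have minc : measurable_fun setT inc by exact: measurable_funB.
pose incf : {mfun skorohod R >-> R} :=
  HB.pack inc (isMeasurableFun.Build _ _ _ _ inc minc).
have mkadd : measurable_fun setT (fun z : R * R => k (z.1 + z.2)%R).
  by apply: measurableT_comp => //; exact: measurable_funD.
exists (fun x => \int[distribution PX incf]_y k (x + y)%R); split.
- exact: (@measurable_fun_fubini_tonelli_F _ _ _ _ _ (distribution PX incf)
    (fun z : R * R => k (z.1 + z.2)%R)).
- by move=> x; exact: integral_ge0.
move=> phi mphi phi0.
(* The weight and the position at time [t] form one F_t-measurable variable, to which independence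
   from the increment applies. *)
pose X (w : skorohod R) := (phi w, coordinate t w).
have mXp : measurable_fun setT (X : past t -> _).
  apply: measurable_fun_pair => //; apply: measurable_coordinate_past.
  by rewrite t0 lexx.
have mX := measurable_fun_past mXp.
pose Xf : {mfun skorohod R >-> (\bar R * R)%type} :=
  HB.pack X (isMeasurableFun.Build _ _ _ _ X mX).
have XY A B : measurable A -> measurable B ->
    PX (Xf @^-1` A `&` incf @^-1` B) = PX (Xf @^-1` A) * PX (incf @^-1` B).
  move=> mA mB; apply: indep => //.
  by have := mXp measurableT _ mA; rewrite setTI.
(* The absolute value makes [f] nonnegative on the whole product space; on the values of [phi] it
   has no effect. *)
pose f (z : (\bar R * R) * R) := `|z.1.1| * k (z.1.2 + z.2)%R.
have mf : measurable_fun setT f.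
  apply: emeasurable_funM.
    apply: measurableT_comp => //; exact: measurableT_comp.
  apply: measurableT_comp => //; apply: measurable_funD => //.
  exact: measurableT_comp.
have f0 z : 0 <= f z by rewrite mule_ge0.
have := independent_integral _ _ _ _ _ _ _ _ _ _ XY f mf f0.
rewrite /f/= => E.
transitivity (\int[PX]_w
    (`|phi w| * k (coordinate t w + (coordinate u w - coordinate t w))%R)).
  by apply: eq_integral => w _; rewrite addrC subrK gee0_abs.
rewrite {}E; apply: eq_integral => w _; rewrite gee0_abs// ge0_integralZl//.
by apply: measurableT_comp => //; exact: measurable_funD.
Qed.

(* [p (coordinate t w)] is the conditional probability of [A] given X_t. *)
Lemma levy_markov (A : set (skorohod R)) (p : R -> R) :
  natural_filtration (@coordinate R) t A ->
  measurable_fun setT p -> (forall x, 0 <= p x)%R ->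
  (forall k : R -> \bar R, measurable_fun setT k -> (forall x, 0 <= k x) ->
    \int[PX]_w ((\1_A w)%:E * k (coordinate t w)) =
    \int[PX]_w ((p (coordinate t w))%:E * k (coordinate t w))) ->
  forall k : R -> \bar R, measurable_fun setT k -> (forall x, 0 <= k x) ->
    \int[PX]_w ((\1_A w)%:E * k (coordinate u w)) =
    \int[PX]_w ((p (coordinate t w))%:E * k (coordinate u w)).
Proof.
move=> FA mp p0 pE k mk k0.
have [kappa [mkappa kappa0 kappaE]] := levy_transition _ mk k0.
(* Both weights, the indicator of [A] and [p] at X_t, are F_t-measurable, so both sides reduce to
   time [t], where [pE] applies to [kappa]. *)
rewrite !kappaE//.
- exact: pE.
- apply/measurable_EFinP; apply: measurableT_comp => //.
  by apply: measurable_coordinate_past; rewrite t0 lexx.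
- by move=> w; rewrite lee_fin.
- by apply/measurable_EFinP; exact: (@measurable_indic _ (past t)).
Qed.

End levy.

(** * Bridges of fixed length and pinning point *)

Section bridge.
Local Open Scope ereal_scope.
Context {R : realType} {PX : probability (skorohod R) R} {f : R -> R -> \bar R}.
Hypothesis PX_levy : levy_process_law PX.
Hypothesis PX_density : marginal_densities PX f.
Variables (r z : R) (Q : {measure set (skorohod R) -> \bar R}).
Hypothesis frz : 0 < f r z < +oo.
Hypothesis Q_bridge : bridge_law PX f r z Q.

(** The density of the bridge law with respect to [PX] on F_u, as a function of the position [x] at
    time [u]. *)
Definition bridge_density (u x : R) := f (r - u)%R (z - x)%R / f r z.

Lemma bridge_density_ge0 (u x : R) : (u < r)%R -> 0 <= bridge_density u x.
Proof.
move=> ur; have [_ f0 _] := PX_density (r - u)%R ltac:(by rewrite subr_gt0).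
by rewrite /bridge_density mule_ge0// inve_ge0 ltW//; case/andP: frz.
Qed.

Lemma measurable_bridge_density (u : R) : (u < r)%R ->
  measurable_fun setT (bridge_density u).
Proof.
move=> ur; have [mf _ _] := PX_density (r - u)%R ltac:(by rewrite subr_gt0).
apply: emeasurable_funM => //; apply: measurableT_comp => //.
exact: measurable_funB.
Qed.

Lemma bridge_integral (u : R) (F : skorohod R -> \bar R) :
  (0 <= u)%R -> (u < r)%R -> measurable_fun setT (F : past u -> \bar R) ->
  (forall w, 0 <= F w) ->
  \int[Q]_w F w = \int[PX]_w (bridge_density u (coordinate u w) * F w).
Proof.
move=> u0 ur mF F0.
have mid : measurable_fun setT (id : skorohod R -> past u).
  by move=> _ B mB; rewrite setTI; exact: natural_filtration_measurable mB.
have mdens : measurable_fun setT (fun w => bridge_density u (coordinate u w)).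
  apply: measurableT_comp; first exact: measurable_bridge_density.
  exact: measurable_coordinate.
transitivity (\int[Q]_w (1 * F w)); first by under [RHS]eq_integral do rewrite mul1e.
(* The comparison takes place on the space [past u], whose measurable sets are exactly those on
   which the density formula for [Q] is available. *)
apply: (positive_functional_ext (U := past u)
  (fun k => \int[Q]_w (1 * k (w : past u)))
  (fun k => \int[PX]_w (bridge_density u (coordinate u w) * k (w : past u)))) => //.
- by apply: (positive_functional_weighted Q setT measurableT (cst 1)
    (id : skorohod R -> past u)).
- apply: (positive_functional_weighted PX setT measurableT
    (fun w => bridge_density u (coordinate u w))
    (id : skorohod R -> past u)) => // w.
  exact: bridge_density_ge0.
- move=> B FB; have mB := natural_filtration_measurable _ FB.
  under eq_integral do rewrite mul1e.
  rewrite integral_indic// setIT (Q_bridge.1 u u0 ur B FB) integral_mkcond.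
  by apply: eq_integral => w _; rewrite epatch_indic.
Qed.

(** On F_t the bridge law has a density with respect to [PX], under which X_t itself has a Lebesgue
    density because [t] is positive. *)
Lemma bridge_null (t : R) (D : set R) : (0 < t)%R -> (t < r)%R -> measurable D ->
  lebesgue_measure D = 0 -> Q (coordinate t @^-1` D) = 0.
Proof.
move=> t0 tr mD D0; have t0' := ltW t0.
have mcD : measurable (coordinate t @^-1` D : set (skorohod R)).
  by rewrite -[X in measurable X]setTI; exact: measurable_coordinate.
rewrite (Q_bridge.1 t t0' tr); last first.
  have := measurable_coordinate_past (s := t) (t := t).
  rewrite t0' lexx => /(_ erefl measurableT _ mD); rewrite setTI; exact.
apply: null_set_integral => //.
  apply: measurable_funTS.
  apply: (measurableT_comp (measurable_bridge_density t tr)).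
  exact: measurable_coordinate.
have [mft _ ft] := PX_density t t0; rewrite [LHS](ft D mD).
by apply: null_set_integral => //; exact: measurable_funTS.
Qed.

Variables (t : R) (A : set (skorohod R)) (p : R -> R).
Hypotheses (t0 : (0 <= t)%R) (tr : (t < r)%R).
Hypothesis FA : natural_filtration (@coordinate R) t A.
Hypotheses (mp : measurable_fun setT p) (p0 : forall x, (0 <= p x)%R).
Hypothesis pE : forall k : R -> \bar R, measurable_fun setT k ->
  (forall x, 0 <= k x) ->
  \int[PX]_w ((\1_A w)%:E * k (coordinate t w)) =
  \int[PX]_w ((p (coordinate t w))%:E * k (coordinate t w)).

(** For [u] before [r], the density on F_u depends on X_u only and is absorbed into the test
    function of [levy_markov]. From [r] on, the path sits at [z] and [k z] factors out. *)
Lemma bridge_markov (u : R) (k : R -> \bar R) : (t <= u)%R ->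
  measurable_fun setT k -> (forall x, 0 <= k x) ->
  \int[Q]_w ((\1_A w)%:E * k (coordinate u w)) =
  \int[Q]_w ((p (coordinate t w))%:E * k (coordinate u w)).
Proof.
have before_r (v : R) (h : R -> \bar R) : (t <= v)%R -> (v < r)%R ->
    measurable_fun setT h -> (forall x, 0 <= h x) ->
    \int[Q]_w ((\1_A w)%:E * h (coordinate v w)) =
    \int[Q]_w ((p (coordinate t w))%:E * h (coordinate v w)).
  move=> tv vr mh h0; have v0 := le_trans t0 tv.
  have mhv : measurable_fun setT (h \o coordinate v : past v -> \bar R).
    by apply: measurableT_comp => //; apply: measurable_coordinate_past;
       rewrite v0 lexx.
  have FvA := natural_filtration_sub tv _ FA.
  rewrite (bridge_integral v)//; last 2 first.
  - apply: emeasurable_funM => //; apply/measurable_EFinP.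
    exact: (@measurable_indic _ (past v)).
  - by move=> w; rewrite mule_ge0// lee_fin.
  rewrite [RHS](bridge_integral v)//; last 2 first.
  - apply: emeasurable_funM => //; apply/measurable_EFinP.
    apply: measurableT_comp => //; apply: measurable_coordinate_past.
    by rewrite t0.
  - by move=> w; rewrite mule_ge0// lee_fin.
  under eq_integral do rewrite muleCA.
  under [RHS]eq_integral do rewrite muleCA.
  apply: (levy_markov PX_levy t v t0 tv A p FA mp p0 pE
    (fun x => bridge_density v x * h x)).
  - apply: emeasurable_funM => //; exact: measurable_bridge_density.
  - by move=> x; rewrite mule_ge0// bridge_density_ge0.
move=> tu mk k0; have [ur|ru] := ltP u r; first exact: before_r.
have mA := natural_filtration_measurable _ FA.
have mcu := measurable_coordinate (le_trans t0 tu).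
have mct := measurable_coordinate t0.
have at_z (F : skorohod R -> \bar R) : measurable_fun setT F -> (forall w, 0 <= F w) ->
    \int[Q]_w (F w * k (coordinate u w)) = \int[Q]_w F w * k z.
  move=> mF F0; rewrite -ge0_integralZr//.
  apply: ge0_ae_eq_integral => //.
  - by apply: emeasurable_funM => //; exact: measurableT_comp.
  - by apply: emeasurable_funM.
  - by move=> w _; rewrite mule_ge0.
  - by move=> w _; rewrite mule_ge0.
  - by apply: filterS Q_bridge.2 => w /= wz _; rewrite wz.
have m1 : measurable_fun setT (fun w => (\1_A w)%:E : \bar R).
  by apply/measurable_EFinP; exact: measurable_indic.
have mpt : measurable_fun setT (fun w => (p (coordinate t w))%:E).
  by apply/measurable_EFinP; exact: measurableT_comp.
rewrite (at_z _ m1)// (at_z _ mpt); last by move=> w; rewrite lee_fin.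
(* With [k z] factored out, only the masses remain to be compared: the case of time [t] and constant
   test function 1. *)
have := before_r t (cst 1) (lexx _) tr (measurable_cst _) (fun=> lee01).
under eq_integral do rewrite mule1.
by under [in X in _ = X -> _]eq_integral do rewrite mule1; move=> ->.
Qed.

End bridge.

(** * Integrals and null sets through a conditional law *)

Lemma regular_conditional_law_integral {d d1 d2} {T : measurableType d}
    {U : measurableType d1} {V : measurableType d2} {R : realType}
    {P : probability T R} {Y : {mfun T >-> V}} {X : {mfun T >-> U}}
    {K : R.-pker U ~> V} (S : set U) (F : V -> \bar R) :
  regular_conditional_law P Y X K -> measurable S ->
  measurable_fun setT F -> (forall y, 0 <= F y)%E ->
  (\int[P]_(w in X @^-1` S) F (Y w) =
   \int[distribution P X]_(x in S) \int[K x]_y F y)%E.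
Proof.
move=> YK mS mF F0.
have mXS : measurable (X @^-1` S).
  by rewrite -[X in measurable X]setTI; exact: measurable_funP.
(* The constant weight 1 gives the left side the shape of [positive_functional_weighted]; on
   indicators the two sides agree by the definition of the conditional law. *)
under eq_integral do rewrite -[F _]mul1e.
apply: (positive_functional_ext
  (fun k => \int[P]_(w in X @^-1` S) (1 * k (Y w)))%E
  (fun k => \int[distribution P X]_(x in S) \int[K x]_y k y)%E) => //.
- exact: (positive_functional_weighted P _ mXS (cst 1%E) Y).
- exact: positive_functional_kernel.
- move=> B mB; under eq_integral do rewrite mul1e.
  under [RHS]eq_integral do rewrite integral_indic// setIT.
  rewrite -YK// setIC -integral_indic//.
  by rewrite -[X in measurable X]setTI; exact: measurable_funP.
Qed.

Lemma regular_conditional_law_null {d d1 d2} {T : measurableType d}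
    {U : measurableType d1} {V : measurableType d2} {R : realType}
    {P : probability T R} {Y : {mfun T >-> V}} {X : {mfun T >-> U}}
    {K : R.-pker U ~> V} (S : set U) (B : set V) :
  regular_conditional_law P Y X K -> measurable S -> measurable B ->
  (\forall x \ae distribution P X, S x -> K x B = 0%E) ->
  P (X @^-1` S `&` Y @^-1` B) = 0%E.
Proof.
move=> YK mS mB KB0; rewrite YK//.
rewrite (ge0_ae_eq_integral (g := cst 0%E))//; first by rewrite integral0.
by apply: measurable_funTS; exact: measurable_kernel.
Qed.

(** * Bridges of random length and pinning point *)

Section random_bridge.
Local Open Scope ereal_scope.
Context {R : realType} {d} {Omega : measurableType d} {P : probability Omega R}.
Context {PX : probability (skorohod R) R} {f : R -> R -> \bar R}.
Hypothesis PX_levy : levy_process_law PX.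
Hypothesis PX_density : marginal_densities PX f.
Context {tau Z : {RV P >-> R}} {zeta : {RV P >-> skorohod R}}.
Context {K : R.-pker (R * R)%type ~> skorohod R}.
Hypothesis f_pos : \forall x \ae distribution P (rv_pair tau Z),
  (0 < f x.1 x.2 < +oo)%E.
Hypothesis K_law : regular_conditional_law P zeta (rv_pair tau Z) K.
Hypothesis K_bridge : \forall x \ae distribution P (rv_pair tau Z),
  bridge_law PX f x.1 x.2 (K x).

(** A pair is (length, pinning point), so the preimage under [rv_pair tau Z] is the event {t <
    tau}. *)
Let unpinned (t : R) : set (R * R) := [set x | (t < x.1)%R].

Let measurable_unpinned t : measurable (unpinned t).
Proof.
rewrite (_ : unpinned t = setT `&` fst @^-1` `]t, +oo[%classic).
  exact: measurable_fst.
by rewrite setTI; apply/seteqP; split => x /=; rewrite in_itv/= andbT.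
Qed.

Lemma measurable_before t : measurable [set w | (t < tau w)%R].
Proof.
rewrite (_ : [set _ | _] = setT `&` tau @^-1` `]t, +oo[%classic).
  exact: measurable_funP.
by rewrite setTI; apply/seteqP; split => x /=; rewrite in_itv/= andbT.
Qed.

Lemma measurable_zeta t : (0 <= t)%R ->
  measurable_fun setT (fun w => coordinate t (zeta w)).
Proof. by move=> t0; apply: measurableT_comp => //; exact: measurable_coordinate. Qed.

Lemma random_bridge_markov (t : R) (A : set (skorohod R)) :
  (0 <= t)%R -> natural_filtration (@coordinate R) t A ->
  exists p : R -> R, [/\ measurable_fun setT p, forall x, (0 <= p x)%R
  & forall (u : R) (k : R -> \bar R), (t <= u)%R -> measurable_fun setT k ->
      (forall x, 0 <= k x) ->
      \int[P]_(w in [set w | (t < tau w)%R])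
        ((\1_A (zeta w))%:E * k (coordinate u (zeta w))) =
      \int[P]_(w in [set w | (t < tau w)%R])
        ((p (coordinate t (zeta w)))%:E * k (coordinate u (zeta w)))].
Proof.
move=> t0 FA; have mA := natural_filtration_measurable _ FA.
pose ct : {mfun skorohod R >-> R} := HB.pack (@coordinate R t)
  (isMeasurableFun.Build _ _ _ _ (@coordinate R t) (measurable_coordinate t0)).
have A0 w : 0 <= (\1_A w)%:E :> \bar R by rewrite lee_fin.
have iA : PX.-integrable setT (fun w => (\1_A w)%:E).
  by apply: integrable_indic => //; rewrite setTI -ge0_fin_numE// fin_num_measure.
(* [p] is chosen under the Levy law, before any bridge, so the same [p] enters [bridge_markov] for
   every pair (r, z) and the identity can be integrated over the law of that pair. *)
have [p [mp p0 pE]] := conditional_density _ _ _ _ _ PX ct _ A0 iA.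
exists p; split => // v k tv mk k0.
have v0 := le_trans t0 tv.
have mkv : measurable_fun setT (k \o @coordinate R v).
  by apply: measurableT_comp => //; exact: measurable_coordinate.
have mpt : measurable_fun setT (fun w => (p (coordinate t w))%:E).
  apply/measurable_EFinP; apply: measurableT_comp => //.
  exact: measurable_coordinate.
have m1 : measurable_fun setT (fun w => (\1_A w)%:E : \bar R).
  by apply/measurable_EFinP; exact: measurable_indic.
pose F1 w := (\1_A w)%:E * k (coordinate v w).
pose F2 w := (p (coordinate t w))%:E * k (coordinate v w).
have mF1 : measurable_fun setT F1 by exact: emeasurable_funM.
have mF2 : measurable_fun setT F2 by exact: emeasurable_funM.
have F10 w : 0 <= F1 w by rewrite mule_ge0// lee_fin.
have F20 w : 0 <= F2 w by rewrite mule_ge0// lee_fin.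
have mt := measurable_unpinned t.
have E1 := regular_conditional_law_integral (unpinned t) F1 K_law mt mF1 F10.
have E2 := regular_conditional_law_integral (unpinned t) F2 K_law mt mF2 F20.
apply: (eq_trans E1); apply: (eq_trans _ (esym E2)).
apply: ge0_ae_eq_integral => //.
- apply: measurable_funTS; apply: measurable_fun_integral_kernel => // B mB.
  exact: measurable_kernel.
- apply: measurable_funTS; apply: measurable_fun_integral_kernel => // B mB.
  exact: measurable_kernel.
- by move=> x _; exact: integral_ge0.
- by move=> x _; exact: integral_ge0.
- apply: filterS2 f_pos K_bridge => -[r z] /= frz Kb tr.
  exact: (bridge_markov PX_levy PX_density r z (K (r, z)) frz Kb t A p).
Qed.

(** [D] is a Lebesgue-null set carrying [Z]: before [tau] the position has a diffuse law and misses
    [D], afterwards it stays at [Z]. Membership of zeta_t in [D] thus reveals whether [tau] has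
    passed. *)
Lemma pinned_ae (D : set R) (t u : R) : measurable D ->
  lebesgue_measure D = 0 -> P (Z @^-1` ~` D) = 0 -> (0 < t)%R -> (t <= u)%R ->
  \forall w \ae P,
    if (t < tau w)%R then ~ D (coordinate t (zeta w))
    else D (coordinate t (zeta w)) /\
         coordinate u (zeta w) = coordinate t (zeta w).
Proof.
move=> mD D0 PZD t0 tu; have t0' := ltW t0; have u0 := le_trans t0' tu.
have mct := @measurable_coordinate R _ t0'.
have mcu := @measurable_coordinate R _ u0.
pose B1 : set (skorohod R) := coordinate t @^-1` D.
(* Equality of the two coordinates is written as the vanishing of their difference, which makes [E]
   a preimage under a measurable function. *)
pose E : set (skorohod R) :=
  (fun w => coordinate u w - coordinate t w)%R @^-1` [set 0%R].
have mB1 : measurable B1 by rewrite -[X in measurable X]setTI; exact: mct.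
have mE : measurable E.
  by rewrite -[X in measurable X]setTI; apply: measurable_funB.
pose B2 := ~` (B1 `&` E).
have mB2 : measurable B2 by apply: measurableC; exact: measurableI.
have N1 : P (rv_pair tau Z @^-1` unpinned t `&` zeta @^-1` B1) = 0.
  apply: (regular_conditional_law_null _ _ K_law) => //.
  apply: filterS2 f_pos K_bridge => -[r z] /= frz Kb tr.
  exact: (bridge_null PX_density r z (K (r, z)) Kb).
have ZD : \forall x \ae distribution P (rv_pair tau Z), D x.2.
  exists (snd @^-1` ~` D); split => //.
  by rewrite -[X in measurable X]setTI; apply: measurable_snd => //; exact: measurableC.
have N2 : P (rv_pair tau Z @^-1` (~` unpinned t) `&` zeta @^-1` B2) = 0.
  apply: (regular_conditional_law_null _ _ K_law) => //; first exact: measurableC.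
  apply: filterS2 ZD K_bridge => -[r z] /= Dz [_ Kz] /negP; rewrite -leNgt => rt.
  apply/negligibleP => //.
  (* When r <= t, both [t] and [u] lie in the stretch where the path equals [z], and [z] is in
     [D]. *)
  apply: negligibleS Kz => w /= nB2 wz; apply: nB2.
  rewrite /B1 /E/= !wz ?subrr//; exact: le_trans tu.
have mpre (S : set (R * R)) (B : set (skorohod R)) : measurable S ->
    measurable B -> measurable (rv_pair tau Z @^-1` S `&` zeta @^-1` B).
  move=> mS mB; apply: measurableI; rewrite -[X in measurable X]setTI.
    exact: measurable_rv_pair.
  exact: measurable_funP.
have [N [mN N0 subN]] : P.-negligible
    ((rv_pair tau Z @^-1` unpinned t `&` zeta @^-1` B1) `|`
     (rv_pair tau Z @^-1` (~` unpinned t) `&` zeta @^-1` B2)).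
  apply: negligibleU; apply/negligibleP => //; apply: mpre => //.
  exact: measurableC.
exists N; split => //; apply: (subset_trans _ subN) => w /=.
case: ifPn => [tw /contrapT Dw|tw nD]; first by left.
right; split; first exact/negP.
by move=> [Dw Ew]; apply: nD; split => //; apply/eqP; rewrite -subr_eq0 Ew.
Qed.

(** On [D] the process has stopped and [g] itself is the version; off [D] the version is [h], the
    conditional expectation given zeta_t alone. The latter suffices for the whole past because
    [random_bridge_markov] trades the indicator of [A] for a function of zeta_t. *)
Lemma random_bridge_version (D : set R) (t u : R) (g : R -> R) :
  measurable D -> lebesgue_measure D = 0 -> P (Z @^-1` ~` D) = 0 ->
  (0 < t)%R -> (t <= u)%R -> measurable_fun setT g -> (forall x, 0 <= g x)%R ->
  P.-integrable setT (fun w => (g (coordinate u (zeta w)))%:E) ->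
  exists v : R -> R, [/\ measurable_fun setT v, forall x, (0 <= v x)%R
  & forall A, natural_filtration (@coordinate R) t A ->
    \int[P]_w ((\1_A (zeta w))%:E * (g (coordinate u (zeta w)))%:E) =
    \int[P]_w ((\1_A (zeta w))%:E * (v (coordinate t (zeta w)))%:E)].
Proof.
move=> mD D0 PZD t0 tu mg g0 ig; have t0' := ltW t0; have u0 := le_trans t0' tu.
have mzt := measurable_zeta t t0'; have mzu := measurable_zeta u u0.
pose zt : {mfun Omega >-> R} := HB.pack (fun w => coordinate t (zeta w))
  (isMeasurableFun.Build _ _ _ _ _ mzt).
have [|h [mh h0 hE]] := conditional_density _ _ _ _ _ P zt
  (fun w => (g (coordinate u (zeta w)))%:E) _ ig.
  by move=> w; rewrite lee_fin.
pose v x := if x \in D then g x else h x.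
have mv : measurable_fun setT v.
  apply: measurable_fun_ifT => //.
  by apply: (measurable_fun_bool true); rewrite setTI preimage_mem_true.
have v0 x : (0 <= v x)%R by rewrite /v; case: ifP.
exists v; split => // A FA.
have [p [mp p0 pE]] := random_bridge_markov t A t0' FA.
have ae := pinned_ae D t u mD D0 PZD t0 tu.
pose before := [set w | (t < tau w)%R].
have mbefore : measurable before := measurable_before t.
have mA : measurable_fun setT (fun w => (\1_A (zeta w))%:E : \bar R).
  apply/measurable_EFinP; apply: (@measurableT_comp _ _ _ _ _ _ (\1_A : _ -> R)) => //.
  by apply: measurable_indic; exact: natural_filtration_measurable FA.
have A0 w : 0 <= (\1_A (zeta w))%:E :> \bar R by rewrite lee_fin.
have mpt : measurable_fun setT (fun w => (p (coordinate t (zeta w)))%:E).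
  by apply/measurable_EFinP; exact: measurableT_comp mp mzt.
have mgu : measurable_fun setT (fun w => (g (coordinate u (zeta w)))%:E).
  by apply/measurable_EFinP; exact: measurableT_comp mg mzu.
have mht : measurable_fun setT (fun w => (h (coordinate t (zeta w)))%:E).
  by apply/measurable_EFinP; exact: measurableT_comp mh mzt.
have mvt : measurable_fun setT (fun w => (v (coordinate t (zeta w)))%:E).
  by apply/measurable_EFinP; exact: measurableT_comp mv mzt.
(* The event {t < tau} is replaced by {zeta_t not in [D]}, which turns the restriction into a factor
   depending on zeta_t. *)
have off_D (F : Omega -> \bar R) : measurable_fun setT F -> (forall w, 0 <= F w) ->
    \int[P]_(w in before) ((p (coordinate t (zeta w)))%:E * F w) =
    \int[P]_w (F w *
      ((p (coordinate t (zeta w)))%:E * (\1_(~` D) (coordinate t (zeta w)))%:E)).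
  move=> mF F0.
  have mpF : measurable_fun setT (fun w => (p (coordinate t (zeta w)))%:E * F w).
    exact: emeasurable_funM.
  have mD1 : measurable_fun setT
      (fun w => (\1_(~` D) (coordinate t (zeta w)))%:E : \bar R).
    apply/measurable_EFinP.
    apply: (@measurableT_comp _ _ _ _ _ _ (\1_(~` D) : _ -> R)) => //.
    by apply: measurable_indic; exact: measurableC.
  rewrite integral_mkcond; apply: ge0_ae_eq_integral => //.
  - by apply/(measurable_restrictT _ mbefore).1; exact: measurable_funTS.
  - by apply: emeasurable_funM => //; exact: emeasurable_funM.
  - by move=> w _; rewrite patchE; case: ifP => // _; rewrite mule_ge0// lee_fin.
  - by move=> w _; rewrite !mule_ge0// lee_fin.
  - apply: filterS ae => w /=; rewrite patchE /before; case: ifPn => [tw nD|tw [wD _]] _.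
      by rewrite mem_set// /indic mem_set// mule1 muleC.
    rewrite memNset; last exact/negP.
    by rewrite /indic memNset ?mule0 ?mule0// => /(_ wD).
have mAg : measurable_fun setT
    (fun w => (\1_A (zeta w))%:E * (g (coordinate u (zeta w)))%:E).
  exact: emeasurable_funM.
have mAv : measurable_fun setT
    (fun w => (\1_A (zeta w))%:E * (v (coordinate t (zeta w)))%:E).
  exact: emeasurable_funM.
have Ag0 w : 0 <= (\1_A (zeta w))%:E * (g (coordinate u (zeta w)))%:E.
  by rewrite mule_ge0// lee_fin.
have Av0 w : 0 <= (\1_A (zeta w))%:E * (v (coordinate t (zeta w)))%:E.
  by rewrite mule_ge0// lee_fin.
have mafter : measurable (~` before) by exact: measurableC.
have dis : [disjoint before & ~` before] by apply/disj_setPS; rewrite setICr.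
rewrite -(setUv before) !ge0_integral_setU//; try by rewrite setUv.
congr (_ + _); last first.
  apply: ge0_ae_eq_integral => //; try by exact: measurable_funTS.
  apply: filterS ae => w /= + /negP/negbTE tw; rewrite tw => -[wD ->].
  by rewrite /v mem_set.
transitivity (\int[P]_(w in before)
    ((\1_A (zeta w))%:E * (h (coordinate t (zeta w)))%:E)); last first.
  apply: ge0_ae_eq_integral => //; try by exact: measurable_funTS.
  - by apply: measurable_funTS; exact: emeasurable_funM.
  - by move=> w _; rewrite mule_ge0// lee_fin.
  - by apply: filterS ae => w /= + tw; rewrite tw => wD; rewrite /v memNset.
have mEg : measurable_fun setT (EFin \o g) by exact/measurable_EFinP.
have mEh : measurable_fun setT (EFin \o h) by exact/measurable_EFinP.
have Eg0 x : 0 <= (EFin \o g) x by rewrite lee_fin.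
have Eh0 x : 0 <= (EFin \o h) x by rewrite lee_fin.
(* On {t < tau}, [pE] is used at time [u] for [g] and at time [t] for [h]. After [off_D], both sides
   are integrals against the same function of zeta_t, where the defining property of [h] applies. *)
apply: (eq_trans (pE u _ tu mEg Eg0)).
apply: (eq_trans _ (esym (pE t _ (lexx t) mEh Eh0))).
apply: (eq_trans (off_D _ mgu _)); first by move=> w; rewrite lee_fin.
apply: (eq_trans _ (esym (off_D _ mht _))); last by move=> w; rewrite lee_fin.
apply: (hE (fun x => (p x)%:E * (\1_(~` D) x)%:E)).
- apply: emeasurable_funM; apply/measurable_EFinP => //.
  by apply: measurable_indic; exact: measurableC.
- by move=> x; rewrite mule_ge0// lee_fin.
Qed.

End random_bridge.

(** * From versions on path space to the Markov property *)

Lemma natural_filtration_comp {R : realType} {T : Type} (Y : T -> skorohod R)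
    (t : R) (B : set T) :
  natural_filtration (fun s w => coordinate s (Y w)) t B ->
  exists2 A, natural_filtration (@coordinate R) t A & B = Y @^-1` A.
Proof.
(* The preimages under [Y] of the events of F_t form a sigma-algebra that contains the generators of
   the past of the process. *)
pose G := preimage_set_system setT Y (natural_filtration (@coordinate R) t).
suff : natural_filtration (fun s w => coordinate s (Y w)) t `<=` G.
  by move=> /[apply] -[A FA <-]; exists A => //; rewrite setTI.
apply: smallest_sub.
  by apply: sigma_algebra_preimage; exact: smallest_sigma_algebra.
move=> _ [s /= st [C mC <-]]; exists (coordinate s @^-1` C).
  by apply: sub_sigma_algebra; exists s => //; exists C => //; rewrite setTI.
by rewrite setTI.
Qed.

Lemma natural_filtration0 {R : realType} (A : set (skorohod R)) :
  natural_filtration (@coordinate R) 0 A -> sigma_rv (@coordinate R 0) A.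
Proof.
apply: smallest_sub.
  exact: sigma_algebra_preimage (sigma_algebra_measurable _).
by move=> B [s /= /andP[s0 s1]]; rewrite (_ : s = 0)//; apply/eqP; rewrite eq_le s1.
Qed.

(** Adding a constant makes a bounded [g] nonnegative. A version given the whole past that is a
    function of the present is also a version given the present, so a single function serves both
    conditional expectations. *)
Lemma markovian_of_version {R : realType} {d} {T : measurableType d}
    {P : probability T R} {Y : {mfun T >-> skorohod R}} :
  (forall (t u : R) (g : R -> R), 0 <= t -> t < u -> measurable_fun setT g ->
    (forall x, 0 <= g x) ->
    P.-integrable setT (fun w => (g (coordinate u (Y w)))%:E) ->
    exists v : R -> R, [/\ measurable_fun setT v, forall x, 0 <= v x
    & forall A, natural_filtration (@coordinate R) t A ->
      (\int[P]_w ((\1_A (Y w))%:E * (g (coordinate u (Y w)))%:E) =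
       \int[P]_w ((\1_A (Y w))%:E * (v (coordinate t (Y w)))%:E))%E]) ->
  markovian P (fun t w => coordinate t (Y w)).
Proof.
move=> version t u t0 tu g mg [M [_ Mg]].
(* [bounded_fun] provides a bound for each number strictly above [M], hence the shift by 1. *)
pose C := M + 1; have gC x : `|g x| <= C by apply: Mg => //; rewrite ltrDl.
pose g' x := g x + C.
have u0 : 0 <= u by rewrite (le_trans t0)// ltW.
have mY s : 0 <= s -> measurable_fun setT (fun w => coordinate s (Y w)).
  by move=> s0; apply: measurableT_comp => //; exact: measurable_coordinate.
have g'0 x : 0 <= g' x by rewrite -lerBlDr sub0r (lerNnormlW (gC x)).
have mg' : measurable_fun setT g' by exact: measurable_funD.
have mgu : measurable_fun setT (fun w => (g' (coordinate u (Y w)))%:E).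
  by apply/measurable_EFinP; exact: measurableT_comp mg' (mY u u0).
have iC : P.-integrable setT (EFin \o cst C) by exact: finite_measure_integrable_cst.
have ig' : P.-integrable setT (fun w => (g' (coordinate u (Y w)))%:E).
  have iC2 : P.-integrable setT (EFin \o cst (C + C)).
    exact: finite_measure_integrable_cst.
  apply: (le_integrable measurableT mgu _ iC2) => w _ /=.
  rewrite lee_fin ger0_norm// (le_trans _ (ler_norm _))// lerD2r.
  exact: le_trans (ler_norm _) (gC _).
have [v [mv v0 vE]] := version t u g' t0 tu mg' g'0 ig'.
have mvt : measurable_fun setT (fun w => (v (coordinate t (Y w)))%:E).
  by apply/measurable_EFinP; exact: measurableT_comp mv (mY t t0).
have iv : P.-integrable setT (fun w => (v (coordinate t (Y w)))%:E).
  apply/integrableP; split => //.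
  (* Taking the whole space for [A] shows that the version has the same integral as the shifted [g],
     which is finite. *)
  have FT : natural_filtration (@coordinate R) t setT.
    exact: (@measurableT _ (past t)).
  have := vE _ FT; rewrite indicT; under eq_integral do rewrite mul1e.
  under [in X in _ = X -> _]eq_integral do rewrite mul1e.
  move=> E; under eq_integral do rewrite gee0_abs ?lee_fin//.
  rewrite -E -ge0_fin_numE; last by apply: integral_ge0 => w _; rewrite lee_fin.
  exact: integrable_fin_num.
pose V w := v (coordinate t (Y w)) - C.
have restr A (F : T -> \bar R) : (\int[P]_(w in Y @^-1` A) F w =
    \int[P]_w ((\1_A (Y w))%:E * F w))%E.
  rewrite [LHS]integral_mkcond; apply: eq_integral => w _.
  by rewrite epatch_indic muleC.
have sub B : sigma_rv (fun w => coordinate t (Y w)) B ->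
    natural_filtration (fun s w => coordinate s (Y w)) t B.
  by move=> tB; apply: sub_sigma_algebra; exists t => //=; rewrite t0 lexx.
have mV B : measurable B -> sigma_rv (fun w => coordinate t (Y w)) (V @^-1` B).
  move=> mB; exists ((fun x => v x - C) @^-1` B); last by rewrite setTI.
  by rewrite -[X in measurable X]setTI; apply: measurable_funB.
have iV : P.-integrable setT (EFin \o V).
  exact: (integrableB measurableT iv iC).
have EV A : natural_filtration (fun s w => coordinate s (Y w)) t A ->
    (\int[P]_(w in A) (V w)%:E = \int[P]_(w in A) (g (coordinate u (Y w)))%:E)%E.
  move=> /natural_filtration_comp[B FB ->].
  have mB : measurable (Y @^-1` B).
    rewrite -[X in measurable X]setTI.
    by apply: measurable_funP => //; exact: natural_filtration_measurable FB.
  have onB F : P.-integrable setT F -> P.-integrable (Y @^-1` B) F.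
    by move=> iF; exact: integrableS iF.
  transitivity (\int[P]_(w in Y @^-1` B) (g' (coordinate u (Y w)) - C)%:E)%E.
    rewrite !integralB_EFin//; try exact: onB.
    by congr (_ - _)%E; rewrite !restr vE.
  by apply: eq_integral => w _; rewrite /g' addrK.
exists V, V; split; last exact: aeW.
- by split => // B mB; apply: sub; exact: mV.
- by split => // A tA; apply: EV; exact: sub.
Qed.

(** * The Markov property for a singular pinning law *)

Theorem theorem2p7 (R : realType) (d : measure_display) (Omega : measurableType d)
    (P : probability Omega R) (P_complete : measure_is_complete P)
    (PX : probability (skorohod R) R) (f : R -> R -> \bar R)
    (PX_levy : levy_process_law PX) (PX_density : marginal_densities PX f)
    (tau Z : {RV P >-> R}) (tau_gt0 : forall w, 0 < tau w)
    (tauZ_indep : independent_rv tau Z)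
    (zeta : {RV P >-> skorohod R}) (zeta_bridge : levy_bridge PX f tau Z zeta)
    (a_ac : R) (Z_weight : ac_weight (distribution P Z) a_ac) :
  a_ac = 0 -> markovian P (fun t w => coordinate t (zeta w)).
Proof.
move=> a0; have [f_pos [K K_law K_bridge]] := zeta_bridge.
have [_ [Ps [Pac [[N mN [PsN leb0]] _ PZE]]]] := Z_weight.
(* The singular part gives [N] mass 0 while the complement of [N] is Lebesgue-null. With weight 0 on
   the absolutely continuous part, the complement carries the law of [Z] and plays the role of
   [D]. *)
have mD : measurable (~` N) by exact: measurableC.
have PZN : P (Z @^-1` ~` ~` N) = 0%E.
  by rewrite setCK; have := PZE N mN; rewrite a0 PsN mule0 mul0e adde0.
apply: markovian_of_version => t u g t0 tu mg g0 ig.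
move: t0; rewrite le_eqVlt => /predU1P[t0|t0].
  subst t.
  have m0 : measurable_fun setT (fun w => coordinate 0 (zeta w)).
    exact: measurable_zeta.
  pose z0 : {mfun Omega >-> R} := HB.pack (fun w => coordinate 0 (zeta w))
    (isMeasurableFun.Build _ _ _ _ _ m0).
  have g0' w : (0 <= (g (coordinate u (zeta w)))%:E)%E by rewrite lee_fin.
  have [h [mh h0 hE]] := conditional_density _ _ _ _ _ P z0 _ g0' ig.
  (* At time 0 every past event has the form {zeta_0 in [B]}, so the indicator of [B] is an
     admissible test function for [h]. *)
  exists h; split => // A /natural_filtration0[B mB <-].
  rewrite setTI; under eq_integral do rewrite muleC.
  under [RHS]eq_integral do rewrite muleC.
  apply: (hE (fun x => (\1_B x)%:E)).
    by apply/measurable_EFinP; exact: measurable_indic.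
  by move=> x; rewrite lee_fin.
exact: (random_bridge_version PX_levy PX_density f_pos K_law K_bridge
  (~` N) t u g mD leb0 PZN t0 (ltW tu) mg g0 ig).
Qed.
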